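(* Let $(X,\tau,E)$ be a soft topological space. Then $(X,\tau,E)$ is soft connected if and only if the only soft sets in $SS(X)_E$ that are both soft open and soft closed over $X$ are $\Phi_E$ and $\widetilde{X}$.
   Context: Let $X$ be a set and $E$ a set of parameters. A soft set $(F,E)$ over $X$ is a map $F:E\to\mathcal{P}(X)$; $SS(X)_E$ is the family of all of them. Union, intersection and complement are taken parameterwise: $(F,E)\cup(G,E)$ is $e\mapsto F(e)\cup G(e)$, $(F,E)\cap(G,E)$ is $e\mapsto F(e)\cap G(e)$, and $(F,E)'$ is $e\mapsto X\setminus F(e)$. $\Phi_E$ is the null soft set $e\mapsto\emptyset$, and $\widetilde{X}$ is the soft set $e\mapsto X$. A soft topological space $(X,\tau,E)$ is given by a family $\tau\subseteq SS(X)_E$ containing $\Phi_E$ and $\widetilde{X}$ and closed under arbitrary unions and finite intersections. Members of $\tau$ are called soft open; a soft set is soft closed if its complement is soft open. A soft separation of $\widetilde{X}$ is a pair $(F,E),(G,E)$ of soft open sets, both different from $\Phi_E$, with $(F,E)\cup(G,E)=\widetilde{X}$ and $(F,E)\cap(G,E)=\Phi_E$. The space $(X,\tau,E)$ is soft connected if no soft separation of $\widetilde{X}$ exists. *)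

(* Defs.v *)
From mathcomp Require Import all_boot.
From mathcomp Require Import boolp classical_sets functions cardinality.

Set Implicit Arguments.
Unset Strict Implicit.
Unset Printing Implicit Defensive.

Local Open Scope classical_set_scope.

Definition soft_set (X E : Type) : Type := E -> set X.

Definition soft_null (X E : Type) : soft_set X E := fun=> set0.

Definition soft_full (X E : Type) : soft_set X E := fun=> setT.

Definition soft_setU (X E : Type) (F G : soft_set X E) : soft_set X E :=
  fun e => F e `|` G e.

Definition soft_setI (X E : Type) (F G : soft_set X E) : soft_set X E :=
  fun e => F e `&` G e.

Definition soft_setC (X E : Type) (F : soft_set X E) : soft_set X E :=
  fun e => ~` F e.

Definition soft_bigcup (X E : Type) (S : set (soft_set X E)) : soft_set X E :=
  fun e => \bigcup_(F in S) F e.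

(* For S = set0 this is the full soft set. *)
Definition soft_bigcap (X E : Type) (S : set (soft_set X E)) : soft_set X E :=
  fun e => \bigcap_(F in S) F e.

Record soft_topology (X E : Type) : Type := SoftTopology {
  soft_open : set (soft_set X E);
  soft_open_null : soft_open (@soft_null X E);
  soft_open_full : soft_open (@soft_full X E);
  soft_open_bigcup : forall S : set (soft_set X E),
    S `<=` soft_open -> soft_open (soft_bigcup S);
  soft_open_bigcap : forall S : set (soft_set X E),
    finite_set S -> S `<=` soft_open -> soft_open (soft_bigcap S)
}.

Definition soft_closed (X E : Type) (tau : soft_topology X E)
    (F : soft_set X E) : Prop :=
  soft_open tau (soft_setC F).

Definition soft_separation (X E : Type) (tau : soft_topology X E)
    (F G : soft_set X E) : Prop :=
  [/\ soft_open tau F /\ soft_open tau G,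
      F <> @soft_null X E,
      G <> @soft_null X E,
      soft_setU F G = @soft_full X E &
      soft_setI F G = @soft_null X E].

Definition soft_connected (X E : Type) (tau : soft_topology X E) : Prop :=
  ~ exists F G : soft_set X E, soft_separation tau F G.

(* Main.v *)
Require Import Defs.
From mathcomp Require Import all_boot.
From mathcomp Require Import boolp classical_sets functions cardinality.

(** The two parts of a soft separation are complementary, so a soft separation
    is the same thing as a clopen soft set other than the null and full ones. *)

Local Open Scope classical_set_scope.

(** Soft sets form a Boolean algebra parameterwise, where complements are unique
    ([soft_setC_unique]). Hence the parts of a separation satisfy [G = soft_setC F], and openness of
    [G] is exactly closedness of [F]. Conversely, a clopen [F] that is neither null nor full forms a
    separation with its complement, by [soft_setUCr] and [soft_setICr]. *)

Lemma soft_setCK (X E : Type) (F : soft_set X E) :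
  soft_setC (soft_setC F) = F.
Proof. by apply: funext => e; rewrite /soft_setC setCK. Qed.

Lemma soft_setC_null (X E : Type) :
  soft_setC (@soft_null X E) = @soft_full X E.
Proof. by apply: funext => e; rewrite /soft_setC setC0. Qed.

Lemma soft_setC_full (X E : Type) :
  soft_setC (@soft_full X E) = @soft_null X E.
Proof. by apply: funext => e; rewrite /soft_setC setCT. Qed.

Lemma soft_setUCr (X E : Type) (F : soft_set X E) :
  soft_setU F (soft_setC F) = @soft_full X E.
Proof. by apply: funext => e; rewrite /soft_setU setUv. Qed.

Lemma soft_setICr (X E : Type) (F : soft_set X E) :
  soft_setI F (soft_setC F) = @soft_null X E.
Proof. by apply: funext => e; rewrite /soft_setI setICr. Qed.

(** Disjointness puts [G] inside the complement of [F]; covering gives the reverse inclusion. *)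
Lemma soft_setC_unique (X E : Type) (F G : soft_set X E) :
  soft_setU F G = @soft_full X E -> soft_setI F G = @soft_null X E ->
  G = soft_setC F.
Proof.
move=> FUG FIG; apply: funext => e; apply/seteqP; split=> x.
  move=> Gx Fx.
  have : soft_setI F G e x by split.
  by rewrite FIG.
move=> nFx.
have : soft_setU F G e x by rewrite FUG.
by case.
Qed.

Theorem theorem2p4 (X E : Type) (tau : soft_topology X E) :
  soft_connected tau <->
  (forall F : soft_set X E,
     soft_open tau F /\ soft_closed tau F <->
     F = @soft_null X E \/ F = @soft_full X E).
Proof.
split=> [conn F|clopenP [F [G [[oF oG] F0 G0 FUG FIG]]]].
  split=> [[oF cF]|[->|->]].
  - have [|F0] := pselect (F = @soft_null X E); first by left.
    have [|FT] := pselect (F = @soft_full X E); first by right.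
    (* Closedness of [F] is by definition openness of the second witness. *)
    case: conn; exists F, (soft_setC F); split=> //.
    + by move=> CF0; apply: FT; rewrite -(soft_setCK _ _ F) CF0 soft_setC_null.
    + exact: soft_setUCr.
    + exact: soft_setICr.
  - rewrite /soft_closed soft_setC_null.
    by split; [exact: soft_open_null|exact: soft_open_full].
  - rewrite /soft_closed soft_setC_full.
    by split; [exact: soft_open_full|exact: soft_open_null].
have GE : G = soft_setC F by exact: soft_setC_unique.
(* The null case contradicts [F0]; if [F] is full, its complement [G] is null, against [G0]. *)
have /clopenP[//|FT] : soft_open tau F /\ soft_closed tau F.
  by rewrite /soft_closed -GE.
by apply: G0; rewrite GE FT soft_setC_full.
Qed.
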